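(* For every $k \geq 3$, $q \geq 2$, and sufficiently large $n$ we have $$t_{k-1}\!\left(\frac{n^{q-1}}{2\sqrt{q}}\right) \leq N_k(q,n) \leq t_{k-1}(2n^{q-1}) .$$
   Context: The parameters $k,q,n$ are integers. Let $K^k_N$ denote the complete $k$-uniform hypergraph on the ordered vertex set $\{1,\ldots,N\}$, i.e. all $k$-element subsets of $\{1,\ldots,N\}$. For vertices $x_1<x_2<\cdots<x_{n+k-1}$, the $n$ edges $\{x_i,x_{i+1},\ldots,x_{i+k-1}\}$, $1\le i\le n$, form a monotone path of length $n$ (length is the number of edges). $N_k(q,n)$ is the smallest integer $N$ such that every coloring of the edges of $K^k_N$ with $q$ colors contains a monochromatic monotone path of length $n$ (all $n$ edges having the same color). The tower function $t_k(x)$ (for real $x$) is a tower of exponents (of base $2$) of height $k-1$ with $x$ at the top: $t_1(x)=x$ and $t_k(x)=2^{t_{k-1}(x)}$ for $k\ge 2$ (so $t_3(x)=2^{2^x}$). *)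

(* Defs.v *)
From mathcomp Require Import all_boot all_order all_algebra.
From mathcomp Require Import reals exp.
Set Implicit Arguments.
Unset Strict Implicit.
Unset Printing Implicit Defensive.
Import Order.TTheory GRing.Theory Num.Theory.
Local Open Scope ring_scope.

(* The ordered vertex set {1, ..., N} is represented by 'I_N.  Vertices
   x_1 < ... < x_(n+k-1) are indexed from 0, so this is the edge
   {x_(i+1), ..., x_(i+k)}, and the edges of the path are those with i < n. *)
Definition path_edge (N k n : nat) (x : 'I_(n + k - 1) -> 'I_N) (i : nat) :
    {set 'I_N} :=
  [set x j | j : 'I_(n + k - 1) & (i <= j < i + k)%N].

(* A coloring is total on {set 'I_N}, but only its values on k-element sets
   matter: when x is strictly increasing and i < n, path_edge x i has
   exactly k elements. *)
Definition has_mono_path (N k q n : nat) (chi : {set 'I_N} -> 'I_q) : Prop :=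
  exists x : 'I_(n + k - 1) -> 'I_N,
    (forall i j : 'I_(n + k - 1), (i < j)%N -> (x i < x j)%N) /\
    exists c : 'I_q, forall i : 'I_n, chi (path_edge x i) = c.

Definition forces_mono_path (k q n N : nat) : Prop :=
  forall chi : {set 'I_N} -> 'I_q, has_mono_path k n chi.

(* N = N_k(q, n), as a relation; at most one N can satisfy it. *)
Definition is_mono_path_number (k q n N : nat) : Prop :=
  forces_mono_path k q n N /\
  forall M : nat, forces_mono_path k q n M -> (N <= M)%N.

(* t_k(x), so that t_1(x) = x and t_k(x) = 2 ^ t_(k-1)(x) for k >= 2; the
   value at k = 0 is immaterial. *)
Definition tower (R : realType) (k : nat) (x : R) : R :=
  iter k.-1 (fun y : R => 2 `^ y) x.

(* Main.v *)
Require Import Defs.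
From mathcomp Require Import all_boot all_order all_algebra.
From mathcomp Require Import boolp reals exp.
From mathcomp Require Import zify ring lra.
Set Implicit Arguments.
Unset Strict Implicit.
Unset Printing Implicit Defensive.
Import Order.TTheory GRing.Theory Num.Theory.

(** Everything goes through maps phi from increasing j-tuples of vertices to a
finite set T with a relation r such that r (phi (x_2 .. x_{j+1})) (phi (x_1 ..
x_j)) never holds; T is shift-free at level j when such a map exists.

Link with colorings.  Take a q-coloring of the k-sets without a monochromatic
monotone path of length n, and send a (k-1)-tuple to the vector in [n]^q of the
lengths of the longest path of each color that starts with it.  Shifting the
tuple along an edge of color c strictly lowers coordinate c, so the new vector
does not dominate the old one.  Conversely, from a map to [n]^q with this
property, color an edge by a coordinate that drops: along a monochromatic path
this coordinate drops n times, but it has only n values.  See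
[no_mono_path_shift_free] and [shift_free_no_mono_path].

Upper bound.  The up-sets generated by the values phi (x, y_1 .. y_{j-1}), over
all x < y_1, form a shift-free map for inclusion one level lower: phi (y_1 ..
y_j) lies in the up-set of y_2 .. y_j but not in that of y_1 .. y_{j-1}
([shift_free_upclosed], [shift_free_powerset]).  At level 1 the map is an
injection of the vertices into T.  Hence N is at most k-3 exponentials on top
of the number of up-sets of [n]^q.  Fixing all but two coordinates, an up-set
becomes a monotone sequence of n heights between 0 and n, so there are at most
C(2n, n)^(n^(q-2)) < 2^(2 n^(q-1)) of them ([card_upclosed_lt]).

Lower bound.  Going up only needs antichains: from a level j map to C(m, h)
values that always changes under the shift, read as h-subsets of an m-set, pick
an element of the difference of the two subsets; this is a level j+1 map to the
m-set that again always changes ([shift_free_binomial]).  Some C(m, h) is at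
least 2^m / (m+1), so N may be as large as k-2 exponentials on top of nearly
the size of any antichain of [n]^q.  The variance of the coordinate sum over
[n]^q is q (n^2 - 1) / 12; by the Chebyshev inequality two thirds of the
vectors lie in about n sqrt q consecutive layers of constant sum, so some layer,
an antichain, has about (2/3) n^(q-1) / sqrt q elements ([large_layer]).  The
excess of 2/3 over 1/2 absorbs the factors m+1 lost at each exponential
([binomial_powR]). *)

Local Open Scope nat_scope.

(** * Shift-free maps: descending with closed sets *)

Definition increasing N (s : seq 'I_N) : bool := sorted (relpre val ltn) s.
Arguments increasing {N} s : simpl never.

(** With the negation of r as arc relation on T, this is a homomorphism from the
shift digraph on j-tuples; for equality, a proper coloring of the shift graph. *)
Definition shift_free (T : Type) (r : rel T) (N j : nat) : Prop :=
  exists phi : seq 'I_N -> T, forall x t y,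
    size (x :: t) = j -> increasing (x :: rcons t y) ->
    ~~ r (phi (rcons t y)) (phi (x :: t)).

Lemma increasing_tail N (x : 'I_N) s : increasing (x :: s) -> increasing s.
Proof. exact: path_sorted. Qed.

Lemma increasing_init N (s : seq 'I_N) y : increasing (rcons s y) -> increasing s.
Proof. by case: s => // a s; rewrite /increasing /= rcons_path => /andP[]. Qed.

Lemma increasing_cons2 N (w x : 'I_N) s :
  increasing [:: w, x & s] = (w < x) && increasing (x :: s).
Proof. by []. Qed.

Lemma shift_free_image T T' (r : rel T) (r' : rel T') (g : T -> T') N j :
  (forall a b, r' (g a) (g b) -> r a b) ->
  shift_free r N j -> shift_free r' N j.
Proof.
move=> gr [phi phiP]; exists (g \o phi) => x t y st inc.
by apply: contra (phiP x t y st inc); apply: gr.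
Qed.

(** The closure, under r on the left, of the values of phi on all increasing
extensions of t by one smaller vertex; an up-set when r is [dominates] below. *)
Definition prefix_closure (T : finType) (r : rel T) N (phi : seq 'I_N -> T) (t : seq 'I_N) :
    {set T} :=
  [set p | [exists x, increasing (x :: t) && r p (phi (x :: t))]].

(** The element phi (x :: rcons t y) separates the two sets: reflexivity puts it in
the first, and membership in the second would relate the values of phi at
w :: x :: t and at its shift. *)
Lemma prefix_closure_shift (T : finType) (r : rel T) N (phi : seq 'I_N -> T) j :
  reflexive r ->
  (forall x t y, size (x :: t) = j.+2 -> increasing (x :: rcons t y) ->
    ~~ r (phi (rcons t y)) (phi (x :: t))) ->
  forall x t y, size (x :: t) = j.+1 -> increasing (x :: rcons t y) ->
    ~~ (prefix_closure r phi (rcons t y) \subset prefix_closure r phi (x :: t)).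
Proof.
move=> rxx phiP x t y st inc; apply/subsetPn; exists (phi (x :: rcons t y)).
  by rewrite inE; apply/existsP; exists x; rewrite inc rxx.
rewrite inE; apply/existsP => -[w /andP[incw]]; apply/negP.
rewrite -rcons_cons; apply: phiP; first by rewrite /= -st.
rewrite rcons_cons increasing_cons2 inc andbT.
by move: incw; rewrite increasing_cons2 => /andP[].
Qed.

Lemma shift_free_powerset (T : finType) (r : rel T) N j :
  reflexive r -> shift_free r N j.+2 ->
  shift_free (fun A B : {set T} => A \subset B) N j.+1.
Proof.
by move=> rxx [phi phiP]; exists (prefix_closure r phi); apply: prefix_closure_shift.
Qed.

Lemma shift_free1_card (T : finType) (r : rel T) N :
  reflexive r -> shift_free r N 1 -> N <= #|T|.
Proof.
move=> rxx [phi phiP].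
have lt_neq (x y : 'I_N) : x < y -> phi [:: x] != phi [:: y].
  move=> xy; apply/eqP => e; have := phiP x [::] y erefl.
  by rewrite /increasing /= xy e rxx => /(_ erefl).
rewrite -{1}(card_ord N); apply: (@leq_card _ _ (fun x : 'I_N => phi [:: x])) => x y e.
by apply: val_inj; case: (ltngtP x y) => // /lt_neq; rewrite e eqxx.
Qed.

Lemma shift_free_card (T : finType) (r : rel T) N j :
  reflexive r -> shift_free r N j.+1 -> N <= iter j (expn 2) #|T|.
Proof.
elim: j T r => [|j IH] T r rxx h; first exact: shift_free1_card h.
rewrite iterSr -cardsT -card_powerset powersetT cardsT.
by apply: IH (shift_free_powerset rxx h) => A.
Qed.

Definition upclosed (T : finType) (r : rel T) (A : {set T}) : bool :=
  [forall a, forall b, (a \in A) && r b a ==> (b \in A)].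

(** Transitivity of r makes every set built in the step closed, so at this level
only the closed sets, far fewer than all subsets, count as values. *)
Lemma shift_free_upclosed (T : finType) (r : rel T) N j :
  reflexive r -> transitive r -> shift_free r N j.+2 ->
  shift_free (fun A B : {A : {set T} | upclosed r A} => val A \subset val B) N j.+1.
Proof.
move=> rxx rtr [phi phiP].
have up t : upclosed r (prefix_closure r phi t).
  apply/forallP => a; apply/forallP => b; apply/implyP => /andP[].
  rewrite !inE => /existsP[x /andP[incx ra]] rba; apply/existsP; exists x.
  by rewrite incx (rtr _ _ _ rba ra).
by exists (fun t => exist (fun A : {set T} => upclosed r A) _ (up t)); apply: prefix_closure_shift.
Qed.

(** * Shift-free maps: ascending with antichains *)

Lemma shift_free_vertices m N : N <= m.+1 -> shift_free (@eq_op 'I_m.+1) N 1.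
Proof.
move=> Nm; exists (fun s => inord (head 0 (map val s))) => x [|//] y _.
rewrite /increasing /= andbT => xy; apply/eqP => /(congr1 val).
by rewrite /= !inordK ?(leq_trans (ltn_ord _)) //; lia.
Qed.

(** Distinct sets of the same size h are never nested, so two different values
always leave an element to pick, and the picked element cannot repeat: it lies
outside the very set in which the previous one lies. *)
Lemma shift_free_binomial m h N j :
  shift_free (@eq_op 'I_('C(m.+1, h))) N j.+1 ->
  shift_free (@eq_op 'I_m.+1) N j.+2.
Proof.
move=> [psi psiP].
have cardD : 'C(m.+1, h) = #|[set A : {set 'I_m.+1} | #|A| == h]|.
  by rewrite card_draws card_ord.
pose E i : {set 'I_m.+1} := enum_val (cast_ord cardD i).
have cardE i : #|E i| = h.
  by have := enum_valP (cast_ord cardD i); rewrite inE => /eqP.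
pose pt A B : 'I_m.+1 := odflt ord0 [pick p in A :\: B].
have ptP i k : i != k -> pt (E i) (E k) \in E i :\: E k.
  move=> ik; rewrite /pt; case: pickP => [p //|no].
  case/eqP: ik; apply: (cast_ord_inj (eq_n := cardD)).
  apply: enum_val_inj; apply/eqP; rewrite eqEcard [X in _ && X]eq_leq ?andbT.
    by rewrite -setD_eq0 -subset0; apply/subsetP => p; rewrite no.
  by rewrite -/(E i) -/(E k) !cardE.
exists (fun s => if s is x :: t then pt (E (psi t)) (E (psi (belast x t))) else ord0).
move=> x [|z t] y //= [st] inc; rewrite belast_rcons.
have inc2 : increasing (z :: rcons t y) by exact: increasing_tail inc.
have inc1 : increasing (x :: rcons (belast z t) (last z t)).
  by rewrite -lastI -/(increasing _); move: inc; rewrite -!rcons_cons => /increasing_init.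
have := ptP _ _ (psiP z t y _ inc2); rewrite /= st => /(_ erefl).
have := ptP _ _ (psiP x (belast z t) (last z t) _ inc1); rewrite /= size_belast st => /(_ erefl).
rewrite -lastI !in_setD => /andP[_ h2] /andP[h1 _].
by apply: contra h1 => /eqP ->.
Qed.

(** * Up-sets of the grid *)

(** The pointwise order of [n]^q, oriented so that closed sets are up-sets. *)
Definition dominates n q (f g : {ffun 'I_q -> 'I_n}) : bool :=
  [forall c, g c <= f c].

Lemma dominates_refl n q : reflexive (@dominates n q).
Proof. by move=> f; apply/forallP. Qed.

Lemma dominates_trans n q : transitive (@dominates n q).
Proof.
move=> g f h /forallP fg /forallP gh; apply/forallP => c.
exact: leq_trans (gh c) (fg c).
Qed.

Definition fcons n q (a : 'I_n) (u : {ffun 'I_q -> 'I_n}) : {ffun 'I_q.+1 -> 'I_n} :=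
  [ffun i => oapp u a (unlift ord0 i)].

Lemma fcons0 n q (a : 'I_n) (u : {ffun 'I_q -> 'I_n}) : fcons a u ord0 = a.
Proof. by rewrite ffunE unlift_none. Qed.

Lemma fconsS n q (a : 'I_n) (u : {ffun 'I_q -> 'I_n}) i :
  fcons a u (lift ord0 i) = u i.
Proof. by rewrite ffunE liftK. Qed.

Lemma fcons_surj n q (f : {ffun 'I_q.+1 -> 'I_n}) :
  f = fcons (f ord0) [ffun i => f (lift ord0 i)].
Proof.
apply/ffunP => i; case: (unliftP ord0 i) => [j|] ->; last by rewrite fcons0.
by rewrite fconsS ffunE.
Qed.

Lemma dominates_fcons n q (a b : 'I_n) (u v : {ffun 'I_q -> 'I_n}) :
  dominates (fcons a u) (fcons b v) = (b <= a) && dominates u v.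
Proof.
apply/forallP/andP => [h|[ba /forallP uv] c].
  split; first by have := h ord0; rewrite !fcons0.
  by apply/forallP => c; have := h (lift ord0 c); rewrite !fconsS.
by case: (unliftP ord0 c) => [j|] ->; rewrite ?fcons0 // !fconsS.
Qed.

(** Up-sets of a chain are nested, so their sizes tell them apart. *)
Lemma upset_ord_eq n (A B : {set 'I_n}) :
  (forall i j : 'I_n, i <= j -> i \in A -> j \in A) ->
  (forall i j : 'I_n, i <= j -> i \in B -> j \in B) ->
  #|A| = #|B| -> A = B.
Proof.
move=> upA upB AB.
have /orP[sAB|sBA] : (A \subset B) || (B \subset A).
- rewrite -implyNb; apply/implyP => /subsetPn[i iA iB]; apply/subsetP => j jB.
  by case: (leqP i j) => [ij|/ltnW ji]; [exact: upA ij iA | case/negP: iB; exact: upB ji jB].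
- by apply/eqP; rewrite eqEcard sAB AB /=.
by apply/esym/eqP; rewrite eqEcard sBA AB /=.
Qed.

(** For fixed u, the slice of A over the first two coordinates is an up-set of
[n]^2; these are its column sizes. *)
Definition heights n q (A : {set {ffun 'I_q.+2 -> 'I_n}}) (u : {ffun 'I_q -> 'I_n}) :
    n.-tuple 'I_n.+1 :=
  [tuple inord #|[set j : 'I_n | fcons i (fcons j u) \in A]| | i < n].

Lemma heights_val n q (A : {set {ffun 'I_q.+2 -> 'I_n}}) u (i : 'I_n) :
  tnth (heights A u) i = #|[set j : 'I_n | fcons i (fcons j u) \in A]| :> nat.
Proof. by rewrite tnth_mktuple inordK // ltnS -[leqRHS]card_ord max_card. Qed.

Lemma upclosedP (T : finType) (r : rel T) (A : {set T}) :
  reflect (forall a b, a \in A -> r b a -> b \in A) (upclosed r A).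
Proof.
apply: (iffP forallP) => [up a b aA rba|up a].
  by have /forallP/(_ b)/implyP := up a; apply; rewrite aA rba.
by apply/forallP => b; apply/implyP => /andP[]; apply: up.
Qed.

Lemma heights_sorted n q (A : {set {ffun 'I_q.+2 -> 'I_n}}) u :
  upclosed (@dominates n q.+2) A -> sorted leq [seq val i | i <- heights A u].
Proof.
move=> /upclosedP upA; apply/(sortedP 0) => i; rewrite size_map size_tuple => Si.
rewrite !(nth_map ord0) ?size_tuple //; last exact: ltnW.
rewrite -(tnth_nth ord0 _ (Ordinal (ltnW Si))) -(tnth_nth ord0 _ (Ordinal Si)).
rewrite /= !heights_val; apply/subset_leq_card/subsetP => j; rewrite !inE => jA.
by apply: upA jA _; rewrite !dominates_fcons /= leqnSn leqnn dominates_refl.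
Qed.

Lemma heights_inj n q (A B : {set {ffun 'I_q.+2 -> 'I_n}}) :
  upclosed (@dominates n q.+2) A -> upclosed (@dominates n q.+2) B ->
  heights A =1 heights B -> A = B.
Proof.
move=> /upclosedP upA /upclosedP upB AB; apply/setP => f.
rewrite (fcons_surj f); set i := f ord0; set g := finfun _.
rewrite (fcons_surj g); set j := g ord0; set u := finfun _.
have up (X : {set {ffun 'I_q.+2 -> 'I_n}}) :
    (forall a b, a \in X -> dominates b a -> b \in X) -> forall j1 j2 : 'I_n, j1 <= j2 ->
    j1 \in [set j : 'I_n | fcons i (fcons j u) \in X] ->
    j2 \in [set j : 'I_n | fcons i (fcons j u) \in X].
  move=> upX j1 j2 le_j; rewrite !inE => jX; apply: upX jX _.
  by rewrite !dominates_fcons le_j leqnn dominates_refl.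
have cardE : #|[set j : 'I_n | fcons i (fcons j u) \in A]| =
             #|[set j : 'I_n | fcons i (fcons j u) \in B]|.
  by rewrite -!heights_val AB.
by have /setP/(_ j) := upset_ord_eq (up A upA) (up B upB) cardE; rewrite !inE.
Qed.

(** The tuples of column sizes are sorted, and C(2n, n) counts the sorted n-tuples
with values in {0, .., n}. *)
Lemma card_upclosed n q :
  #|{: {A : {set {ffun 'I_q.+2 -> 'I_n}} | upclosed (@dominates n q.+2) A}}|
    <= 'C(n + n, n) ^ (n ^ q).
Proof.
pose S := {t : n.-tuple 'I_n.+1 | sorted leq [seq val i | i <- t]}.
have cardS : #|{: S}| = 'C(n + n, n) by rewrite card_sig -card_sorted_tuples cardsE.
have -> : 'C(n + n, n) ^ (n ^ q) = #|{ffun {ffun 'I_q -> 'I_n} -> S}|.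
  by rewrite !card_ffun !card_ord cardS.
pose enc (A : {A : {set {ffun 'I_q.+2 -> 'I_n}} | upclosed (@dominates n q.+2) A}) :=
  [ffun u => Sub (heights (val A) u) (heights_sorted u (valP A)) : S].
apply: (leq_card enc) => A B /ffunP e; apply: val_inj.
apply: (heights_inj (valP A) (valP B)) => u.
by have /(congr1 val) := e u; rewrite !ffunE.
Qed.

Lemma central_bin_lt n : 0 < n -> 'C(n + n, n) < 4 ^ n.
Proof.
move=> n0; rewrite (_ : 4 ^ n = \sum_(i < (n + n).+1) 'C(n + n, i)); last first.
  transitivity ((1 + 1) ^ (n + n)); first by rewrite expnD -expnMn.
  by rewrite expnDn; apply: eq_bigr => i _; rewrite !exp1n !muln1.
have nlt : n < (n + n).+1 by lia.
rewrite (bigD1 ord0) //= (bigD1 (Ordinal nlt)) /=; last by rewrite -val_eqE /= -lt0n.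
by rewrite bin0; lia.
Qed.

Lemma card_upclosed_lt n q : 0 < n ->
  #|{: {A : {set {ffun 'I_q.+2 -> 'I_n}} | upclosed (@dominates n q.+2) A}}|
    < 2 ^ (2 * n ^ q.+1).
Proof.
move=> n0; apply: leq_ltn_trans (card_upclosed n q) _.
rewrite (expnS n) mulnA !expnM ltn_exp2r ?expn_gt0 ?n0 //.
exact: central_bin_lt.
Qed.

(** * Large antichains of the grid *)

Lemma big_fcons (R : Type) (idx : R) (op : Monoid.com_law idx) n q
    (F : {ffun 'I_q.+1 -> 'I_n} -> R) :
  \big[op/idx]_f F f = \big[op/idx]_a \big[op/idx]_u F (fcons a u).
Proof.
rewrite pair_bigA /= (reindex (fun p : 'I_n * {ffun 'I_q -> 'I_n} => fcons p.1 p.2)) //=.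
exists (fun f => (f ord0, [ffun i => f (lift ord0 i)])) => [[a u]|f] _ /=; last first.
  by rewrite -fcons_surj.
by rewrite fcons0; congr pair; apply/ffunP => i; rewrite ffunE fconsS.
Qed.

Definition height n q (f : {ffun 'I_q -> 'I_n}) : nat := \sum_c f c.

Lemma height_fcons n q (a : 'I_n) (u : {ffun 'I_q -> 'I_n}) :
  height (fcons a u) = a + height u.
Proof.
rewrite /height big_ord_recl fcons0; congr addn.
by apply: eq_bigr => i _; rewrite fconsS.
Qed.

(** Hence every layer of constant coordinate sum is an antichain. *)
Lemma dominates_height n q (f g : {ffun 'I_q -> 'I_n}) :
  height f = height g -> dominates f g -> f = g.
Proof.
move=> fg /forallP dom; apply/ffunP => c; apply/val_inj/eqP; rewrite /= eq_sym.
have := @leqif_sum _ predT (fun c => g c == f c) (fun c => g c : nat) (fun c => f c : nat)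
  (fun c _ => leqif_eq (dom c)).
by case=> _; rewrite -/(height f) -/(height g) fg eqxx => /esym/forallP/(_ c).
Qed.

Local Open Scope ring_scope.

(** Twice the deviation of the coordinate sum from its mean q n / 2 over
{0, .., n}^q; the factor 2 keeps it an integer. *)
Definition centered n q (f : {ffun 'I_q -> 'I_n.+1}) : int :=
  2 * (height f)%:Z - (q * n)%N%:Z.

Lemma centered_fcons n q (a : 'I_n.+1) (u : {ffun 'I_q -> 'I_n.+1}) :
  centered (fcons a u) = (2 * (val a)%:Z - n%:Z) + centered u.
Proof. by rewrite /centered height_fcons mulSn /=; lia. Qed.

Lemma sum_centered1 n m : \sum_(a < m) (2 * (val a)%:Z - n%:Z) = m%:Z * (m%:Z - 1 - n%:Z).
Proof.
elim: m => [|m IH]; first by rewrite big_ord0 mul0r.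
by rewrite big_ord_recr /= IH !intS; ring.
Qed.

Lemma sum_centered1_sq n :
  3 * \sum_(a < n.+1) (2 * (val a)%:Z - n%:Z) ^+ 2 = n.+1%:Z * (n.+1%:Z ^+ 2 - 1).
Proof.
have gen m : 3 * \sum_(a < m) (2 * (val a)%:Z - n%:Z) ^+ 2 =
    m%:Z * (2 * (m%:Z - 1) * (2 * m%:Z - 1) - 6 * n%:Z * (m%:Z - 1) + 3 * n%:Z ^+ 2).
  elim: m => [|m IH]; first by rewrite big_ord0 mulr0 mul0r.
  by rewrite big_ord_recr /= mulrDr IH !intS; ring.
by rewrite gen !intS; ring.
Qed.

Lemma sum_centered n q : \sum_(f : {ffun 'I_q -> 'I_n.+1}) centered f = 0.
Proof.
elim: q => [|q IH].
  by rewrite big1 // => f _; rewrite /centered /height big_ord0 mul0n.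
rewrite big_fcons; under eq_bigr => a _ do under eq_bigr => u _ do rewrite centered_fcons.
under eq_bigr => a _ do rewrite big_split /= IH addr0 sumr_const.
by rewrite sumrMnl sum_centered1 (_ : _ * _ = 0) ?mul0rn // !intS; ring.
Qed.

(** The cross terms vanish by [sum_centered], so the second moment is additive in
the coordinates. *)
Lemma sum_centered_sq n q :
  3 * \sum_(f : {ffun 'I_q -> 'I_n.+1}) centered f ^+ 2 =
  q%:Z * n.+1%:Z ^+ q * (n.+1%:Z ^+ 2 - 1).
Proof.
elim: q => [|q IH].
  by rewrite big1 ?mulr0 ?mul0r // => f _; rewrite /centered /height big_ord0 mul0n.
have card : (#|{: {ffun 'I_q -> 'I_n.+1}}|)%:Z = n.+1%:Z ^+ q.
  by rewrite card_ffun !card_ord -natz natrX natz.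
have inner (a : 'I_n.+1) :
    \sum_(u : {ffun 'I_q -> 'I_n.+1}) centered (fcons a u) ^+ 2 =
    (2 * (val a)%:Z - n%:Z) ^+ 2 * n.+1%:Z ^+ q +
    \sum_(u : {ffun 'I_q -> 'I_n.+1}) centered u ^+ 2.
  set g := _ - _; transitivity (\sum_(u : {ffun 'I_q -> 'I_n.+1})
      (g ^+ 2 + (2 * g) * centered u + centered u ^+ 2)).
    by apply: eq_bigr => u _; rewrite centered_fcons -/g; ring.
  rewrite !big_split /= -[X in _ + X + _]mulr_sumr sum_centered mulr0 addr0.
  by rewrite sumr_const -card -mulr_natr natz.
rewrite big_fcons (eq_bigr _ (fun a _ => inner a)) big_split /= sumr_const card_ord.
rewrite -mulr_suml mulrDr mulrA sum_centered1_sq mulrnAr IH.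
by rewrite -mulr_natr natz (exprS _ q) (intS q); ring.
Qed.

Local Open Scope nat_scope.

Definition layer n q (s : nat) : {set {ffun 'I_q -> 'I_n}} :=
  [set f | height f == s].

(** The Chebyshev inequality at squared distance three times the variance: at most
a third of the vectors have a deviation above d. *)
Lemma central_card n q d : q * n.+1 ^ 2 < d.+1 ^ 2 ->
  2 * n.+1 ^ q <=
  3 * #|[set f : {ffun 'I_q -> 'I_n.+1} | `|centered f| <= d]|.
Proof.
move=> dq; set A := [set f | _].
have cardT : #|A| + #|~: A| = n.+1 ^ q by rewrite cardsC card_ffun !card_ord.
have out : 3 * #|~: A| <= n.+1 ^ q; last by lia.
have cheb : 3 * (#|~: A| * d.+1 ^ 2) <= q * n.+1 ^ q * n.+1 ^ 2.
  have := sum_centered_sq n q; rewrite mulrBr mulr1 => /eqP; rewrite eq_sym subr_eq => /eqP e.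
  suff /(ler_wpM2l (x := 3%:Z) isT) le_sum : ((#|~: A| * d.+1 ^ 2)%N%:Z <=
      \sum_(f : {ffun 'I_q -> 'I_n.+1}) centered f ^+ 2)%R by lia.
  (* Keep only the vectors outside A in the second moment. *)
  rewrite (bigID (mem A)) /= (_ : _%:Z = \sum_(f in ~: A) (d.+1 ^ 2)%N%:Z)%R; last first.
    by rewrite sumr_const -mulr_natl natz PoszM.
  rewrite -[leLHS]add0r lerD ?sumr_ge0 // => [f _|]; first exact: sqr_ge0.
  rewrite (eq_bigl (fun f => f \notin A)) => [|f]; last by rewrite inE.
  by apply: ler_sum => f; rewrite inE => fA; nia.
rewrite -(leq_pmul2r (m := d.+1 ^ 2)) // -mulnA (leq_trans cheb) //.
by rewrite mulnAC mulnC leq_mul2l (ltnW dq) orbT.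
Qed.

(** A deviation of at most d leaves only d + 1 possible coordinate sums. *)
Lemma layer_pigeonhole n q d :
  exists s, #|[set f : {ffun 'I_q -> 'I_n.+1} | `|centered f| <= d]| <= d.+1 * #|layer n.+1 q s|.
Proof.
set A := [set f | _]; pose s0 := uphalf (q * n - d).
have Ah f : f \in A -> s0 <= height f < s0 + d.+1.
  by rewrite inE /centered /s0 => fA; apply/andP; split; lia.
pose h j := #|layer n.+1 q (s0 + j)|.
pose j0 := [arg max_(j > ord0 : 'I_d.+1) h j].
have j0P j : h (j : 'I_d.+1) <= h j0 by rewrite /j0; case: arg_maxnP => // i _; apply.
exists (s0 + j0); rewrite -/(h j0) -sum1_card.
rewrite (partition_big (fun f => inord (height f - s0) : 'I_d.+1) predT) //=.
rewrite (_ : d.+1 * _ = \sum_(j < d.+1) h j0); last by rewrite sum_nat_const card_ord.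
apply: leq_sum => j _.
apply: leq_trans (j0P j); rewrite sum1_card; apply/subset_leq_card/subsetP => f.
rewrite !inE => /andP[/Ah /andP[le_s0 lt_s] /eqP <-].
by rewrite inordK ?subnKC // ltn_subLR.
Qed.

(** * Colorings and shift-free maps *)

Lemma path_edge_window N k n (x : 'I_(n + k - 1) -> 'I_N) i :
  path_edge x i = [set z in take k (drop i [seq x j | j <- enum 'I_(n + k - 1)])].
Proof.
rewrite -map_drop -map_take.
have win (j : 'I_(n + k - 1)) :
    (j \in take k (drop i (enum 'I_(n + k - 1)))) = (i <= j < i + k).
  rewrite -(mem_map val_inj) map_take map_drop val_enum_ord drop_iota take_iota mem_iota.
  by have := ltn_ord j; rewrite /=; lia.
apply/setP => z; rewrite inE; apply/imsetP/mapP => -[j jw ->]; exists j => //.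
  by rewrite win; move: jw; rewrite inE.
by rewrite inE -win.
Qed.

Lemma increasing_codom N m (x : 'I_m -> 'I_N) :
  (forall i j : 'I_m, i < j -> x i < x j) -> increasing [seq x j | j <- enum 'I_m].
Proof.
move=> x_inc; rewrite /increasing sorted_map.
apply: (@sub_sorted _ (relpre val ltn)) => [i j|]; first exact: x_inc.
by rewrite -(sorted_map (f := val)) val_enum_ord iota_ltn_sorted.
Qed.

Lemma enum_increasing N (s : seq 'I_N) : increasing s -> enum [set z in s] = s.
Proof.
move=> inc; apply: (irr_sorted_eq (leT := relpre val ltn)) => //.
- by move=> y x z; apply: ltn_trans.
- by move=> x; apply: ltnn.
- rewrite {1}/enum_mem; apply: sorted_filter; first by move=> y x z; apply: ltn_trans.
  by rewrite -enumT -(sorted_map (f := val)) val_enum_ord iota_ltn_sorted.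
by move=> z; rewrite mem_enum inE.
Qed.

Lemma increasing_window N i k (s : seq 'I_N) :
  increasing s -> increasing (take k (drop i s)).
Proof. by move=> inc; apply/take_sorted/drop_sorted. Qed.

(** A monochromatic path of m edges in color c starting with the vertices of e. *)
Fixpoint ray N q (chi : {set 'I_N} -> 'I_q) (c : 'I_q) (m : nat) (e : seq 'I_N) : bool :=
  if m is m'.+1 then
    [exists y, [&& increasing (rcons e y), chi [set z in rcons e y] == c &
                   ray chi c m' (behead (rcons e y))]]
  else true.

Lemma ray_path N q (chi : {set 'I_N} -> 'I_q) c m h e :
  increasing (h :: e) -> ray chi c m (h :: e) ->
  exists t, [/\ size t = m, increasing (h :: e ++ t) &
    forall i, i < m -> chi [set z in take (size e).+2 (drop i (h :: e ++ t))] = c].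
Proof.
elim: m h e => [|m IH] h e inc /=; first by exists [::]; rewrite cats0.
case/existsP => y /and3P[incy /eqP chic].
have [z [w ezw]] : exists z w, rcons e y = z :: w.
  by case: e {inc incy chic} => [|z w]; [exists y, [::] | exists z, (rcons w y)].
have sw : size w = size e by have := congr1 size ezw; rewrite size_rcons => -[].
rewrite ezw => /IH[|t [st inct chit]]; first by rewrite -ezw; exact: increasing_tail incy.
exists (y :: t); rewrite /= st -cat_rcons ezw; split=> //.
  move: incy; rewrite ezw !increasing_cons2 inct andbT.
  by case/andP.
case=> [_|i lt_im]; last by rewrite -sw; apply: chit.
by rewrite -[RHS]chic ezw -sw /= take_size_cat.
Qed.

Lemma ray_mono_path N q n k (chi : {set 'I_N} -> 'I_q) c h e :
  size e = k -> increasing (h :: e) -> ray chi c n (h :: e) -> has_mono_path k.+2 n chi.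
Proof.
move=> se inc /(ray_path inc)[t [st inct chit]].
have ss : size (h :: e ++ t) == n + k.+2 - 1 by rewrite /= size_cat se st; lia.
exists (tnth (Tuple ss)); split.
  move=> i j ij; rewrite !(tnth_nth h).
  by apply: (sorted_ltn_nth (leT := relpre val ltn)) ij; rewrite ?inE ?size_tuple //;
    move=> ? ? ?; apply: ltn_trans.
exists c => i; rewrite path_edge_window map_tnth_enum.
by have := chit i (ltn_ord i); rewrite se.
Qed.

(** Coordinate c of the map is the length of the longest path of color c starting
with the tuple.  If the edge x :: rcons t y has color c, it extends every such
path from rcons t y, so coordinate c is larger at x :: t. *)
Lemma no_mono_path_shift_free N q n k (chi : {set 'I_N} -> 'I_q) :
  ~ has_mono_path k.+2 n.+1 chi -> shift_free (@dominates n.+1 q) N k.+1.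
Proof.
move=> nopath.
pose phi e := [ffun c => [arg max_(m > ord0 : 'I_n.+1 | ray chi c m e) (m : nat)]].
have phiP e c : ray chi c (phi e c) e /\
    forall m : 'I_n.+1, ray chi c m e -> m <= phi e c.
  by rewrite ffunE; case: arg_maxnP.
exists phi => x t y [st] inc; apply/negP => /forallP.
pose c := chi [set z in x :: rcons t y]; move=> /(_ c).
have [ry _] := phiP (rcons t y) c; have [_ mx] := phiP (x :: t) c.
set m := phi (rcons t y) c in ry *.
have rx : ray chi c m.+1 (x :: t).
  by apply/existsP; exists y; rewrite rcons_cons inc eqxx.
(* Either the longer path is a candidate for the maximum at x :: t, or it has
   the forbidden length. *)
have [mn|] := ltnP m.+1 n.+1; first by rewrite leqNgt (mx (Ordinal mn)).
move=> nm; case: nopath; apply: (@ray_mono_path _ _ _ _ chi c x t) => //.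
  exact: (@increasing_init _ (x :: t) y).
by have -> : n.+1 = m.+1; first by have := ltn_ord m; lia.
Qed.

(** The color of an edge is a coordinate where phi drops from its first k+1 to
its last k+1 vertices. *)
Lemma shift_free_no_mono_path N q n k :
  0 < q -> shift_free (@dominates n q) N k.+1 ->
  exists chi : {set 'I_N} -> 'I_q, ~ has_mono_path k.+2 n chi.
Proof.
case: q => // q _ [phi phiP].
pose gap s s' : 'I_q.+1 := odflt ord0 [pick c | phi s' c < phi s c].
exists (fun A : {set 'I_N} => if enum A is x :: t then gap (belast x t) t else ord0).
case=> x [x_inc [c chic]].
set s := [seq x j | j <- enum 'I_(n + k.+2 - 1)].
have inc : increasing s by apply: increasing_codom.
have ss : size s = n + k.+1 by rewrite size_map size_enum_ord; lia.
have dec i : i < n -> phi (take k.+1 (drop i.+1 s)) c < phi (take k.+1 (drop i s)) c.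
  move=> lt_in; have := chic (Ordinal lt_in); rewrite path_edge_window -/s /=.
  have incw := increasing_window i k.+2 inc; rewrite enum_increasing //.
  have : size (drop i s) = n - i + k.+1 by rewrite size_drop; lia.
  rewrite -(add1n i) -drop_drop; case: (drop i s) incw => [|z u] incw /= sw; first by lia.
  rewrite drop0 => <-; have su : k < size u by lia.
  have take_rcons : take k.+1 u = rcons (take k u) (nth z u k) by rewrite (take_nth z).
  rewrite /gap take_rcons belast_rcons -take_rcons; case: pickP => [c' //|no].
  have := phiP z (take k u) (nth z u k).
  rewrite -take_rcons -[z :: take k.+1 u]/(take k.+2 (z :: u)).
  rewrite /= size_takel ?(ltnW su) // => /(_ erefl incw) /negP[].
  by apply/forallP => c'; rewrite leqNgt; apply/negP => lt; have := no c'; rewrite lt.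
(* Each of the n edges costs one unit of a coordinate smaller than n. *)
have bound i : i <= n -> phi (take k.+1 (drop i s)) c + i < n.
  elim: i => [|i IH] lt_in; first by rewrite addn0 ltn_ord.
  by have := IH (ltnW lt_in); have := dec i lt_in; lia.
by have := bound n (leqnn n); lia.
Qed.

(** * From shift-free maps to bounds on the path number *)

(** The m + 1 binomial coefficients of row m sum to 2^m. *)
Lemma large_binomial m : exists h, 2 ^ m <= m.+1 * 'C(m, h).
Proof.
pose h0 := [arg max_(h > ord0 : 'I_m.+1) 'C(m, h)].
have h0P h : 'C(m, (h : 'I_m.+1)) <= 'C(m, h0).
  by rewrite /h0; case: arg_maxnP => // i _; apply.
exists h0; rewrite (_ : 2 ^ m = \sum_(i < m.+1) 'C(m, i)); last first.
  by rewrite (expnDn 1 1); apply: eq_bigr => i _; rewrite !exp1n !muln1.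
rewrite (_ : _ * _ = \sum_(i < m.+1) 'C(m, h0)); first exact: leq_sum.
by rewrite sum_nat_const card_ord.
Qed.

Lemma eight_succ_le_exp a : 6 <= a -> 8 * a.+1 <= 2 ^ a.
Proof.
elim: a => // a IH; rewrite leq_eqVlt => /predU1P[<- //|/IH].
by rewrite expnS; lia.
Qed.

Lemma shift_free_dominates n q s N j :
  shift_free (@eq_op 'I_#|layer n q s|) N j -> shift_free (@dominates n q) N j.
Proof.
apply: (shift_free_image (g := fun i => enum_val i)) => a b ab.
apply/eqP/enum_val_inj/dominates_height => //.
by have := enum_valP a; have := enum_valP b; rewrite !inE => /eqP -> /eqP ->.
Qed.

Lemma iter_expn_lt i a b : a < b -> iter i (expn 2) a < iter i (expn 2) b.
Proof. by move=> ab; elim: i => //= i; rewrite ltn_exp2l. Qed.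

Lemma sqrt_floor a : exists2 d, d ^ 2 <= a & a < d.+1 ^ 2.
Proof.
have ex0 : exists d, d ^ 2 <= a by exists 0.
have bd d : d ^ 2 <= a -> d <= a by nia.
have [d da mx] := ex_maxnP ex0 bd.
by exists d => //; rewrite ltnNge; apply/negP => /mx; rewrite ltnn.
Qed.

(** One step from [n]^q to its up-sets and k steps through powersets lead from
level k + 2 to level 1. *)
Lemma card_upclosed_forces k q n :
  0 < n -> forces_mono_path k.+3 q.+2 n
    (iter k (expn 2) #|{: {A : {set {ffun 'I_q.+2 -> 'I_n}} | upclosed (@dominates n q.+2) A}}|).+1.
Proof.
case: n => // n _ chi; apply: contrapT => /no_mono_path_shift_free h.
have /shift_free_card := shift_free_upclosed (@dominates_refl _ _) (@dominates_trans _ _) h.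
by rewrite ltnn => /(_ (fun A => subxx _)).
Qed.

Local Open Scope ring_scope.

Lemma iter_expn_powR (R : realType) i b :
  (iter i (expn 2) b)%:R = iter i (fun y : R => 2 `^ y) b%:R.
Proof. by elim: i => //= i <-; rewrite natrX powR_mulrn. Qed.

(** The factor 6/5 is reproduced at each exponential: since y is at most m - m/6,
it is enough that 2^(m/6) beats 6/5 (m + 1). *)
Lemma binomial_powR (R : realType) m (y : R) : 30 <= y -> 6 / 5 * y <= m%:R ->
  exists h, 6 / 5 * 2 `^ y <= 'C(m, h)%:R.
Proof.
move=> y30 ym; have [h hP] := large_binomial m; exists h.
have m36 : (36 <= m)%N by rewrite -(ler_nat R); lra.
pose a := (m %/ 6)%N; have a6 : (6 * a <= m)%N by rewrite /a; lia.
have powy : 2 `^ y <= 2 ^+ (m - a) :> R.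
  rewrite -powR_mulrn // ler_powR ?ler1n // natrB; last by lia.
  by move: a6; rewrite -(ler_nat R) natrM; lra.
have key : (6 * 2 ^ (m - a) <= 5 * 'C(m, h))%N.
  rewrite -(leq_pmul2r (ltn0Sn m)).
  have : (8 * a.+1 <= 2 ^ a)%N by apply: eight_succ_le_exp; rewrite /a; lia.
  have : (6 * m.+1 <= 40 * a.+1)%N by rewrite /a; lia.
  have : (2 ^ m = 2 ^ (m - a) * 2 ^ a)%N by rewrite -expnD subnK //; lia.
  nia.
move: key; rewrite -(ler_nat R) !natrM natrX; lra.
Qed.

Lemma shift_free_tower (R : realType) i m N (y : R) :
  30 <= y -> 6 / 5 * y <= m%:R -> N%:R <= iter i (fun y : R => 2 `^ y) y ->
  shift_free (@eq_op 'I_m) N i.+1.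
Proof.
elim: i m y => [|i IH] m y y30 ym.
  move=> /= Ny; case: m ym => [|m] ym; first by lra.
  by apply: shift_free_vertices; rewrite -(ler_nat R); lra.
rewrite iterSr; have [h hP] := binomial_powR y30 ym.
case: m ym hP => [|m] ym hP Ny; first by lra.
apply: (@shift_free_binomial m h); apply: IH hP Ny.
(* The new base value 2^y is at least 2^5 >= 30. *)
have : 2 `^ 5 <= 2 `^ y :> R by rewrite ler_powR ?ler1n //; lra.
rewrite powR_mulrn //; lra.
Qed.

(** The Chebyshev window has at most n sqrt q + 1 layers; the loss from 2/3 to 3/5
pays for this 1, which is at most a ninth of n sqrt q. *)
Lemma large_layer (R : realType) n q : (60 * q <= n)%N -> (0 < q)%N ->
  exists s, 3 / 5 * (n%:R ^+ q.-1 / Num.sqrt q%:R) <= #|layer n q s|%:R :> R.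
Proof.
case: q => // q; case: n => [|n] // nq _.
have [d d_le d_gt] := sqrt_floor (q.+1 * n.+1 ^ 2)%N.
have [s sP] := layer_pigeonhole n q.+1 d; exists s => /=.
have := leq_trans (central_card d_gt) (leq_mul (leqnn 3) sP).
set m := #|_|; rewrite -(ler_nat R) !natrM natrX exprS -[d.+1]addn1 natrD.
set r := Num.sqrt _; set P := n.+1%:R ^+ q; set nn := n.+1%:R.
have r2 : r ^+ 2 = q.+1%:R by rewrite sqr_sqrtr.
have r1 : 1 <= r by rewrite -sqrtr1 ler_wsqrtr // ler1n.
have n60 : 60 <= nn by rewrite ler_nat; lia.
have d_rn : d%:R <= r * nn.
  rewrite -(@ler_pXn2r _ 2) ?nnegrE ?mulr_ge0 //; last by lra.
  by rewrite exprMn r2 -!natrX -natrM ler_nat.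
have P0 : 0 <= P by rewrite exprn_ge0.
have m0 : 0 <= m%:R :> R by [].
move=> h; rewrite mulrA ler_pdivrMr; last by lra.
have : 2 * (nn * P) <= 3 * ((10 / 9 * (r * nn)) * m%:R).
  apply: le_trans h _; rewrite ler_wpM2l // ler_wpM2r //; nra.
rewrite (_ : 3 * _ = nn * (10 / 3 * (m%:R * r))); last by lra.
rewrite mulrCA ler_pM2l; last by lra.
lra.
Qed.

Lemma mono_path_number_exists k q n M : forces_mono_path k q n M ->
  exists2 N, is_mono_path_number k q n N & (N <= M)%N.
Proof.
move=> forcesM.
have ex : exists N, `[< forces_mono_path k q n N >] by exists M; apply/asboolP.
have [N /asboolP forcesN minN] := ex_minnP ex; exists N; last by apply/minN/asboolP.
by split=> // N' /asboolP /minN.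
Qed.

Theorem corollary3 (R : realType) (k q : nat) (hk : (3 <= k)%N)
    (hq : (2 <= q)%N) :
  exists n0 : nat, forall n : nat, (n0 <= n)%N ->
    exists N : nat, is_mono_path_number k q n N /\
      tower (k - 1) (n%:R ^+ (q - 1) / (2 * Num.sqrt q%:R)) <= N%:R :> R /\
      N%:R <= tower (k - 1) (2 * n%:R ^+ (q - 1)) :> R.
Proof.
(* With n >= 60 q, the exponent y below is at least n / (2 sqrt q) >= 30, where
   the estimate for binomial coefficients starts to hold. *)
exists (60 * q)%N => n n_large.
case: k hk => [|[|[|k]]] // _; rewrite /tower subn1 /=.
have q_gt0 : (0 < q)%N by lia.
have n_gt0 : (0 < n)%N by lia.
set M := (iter k (expn 2)
  #|{: {A : {set {ffun 'I_q -> 'I_n}} | upclosed (@dominates n q) A}}|).+1.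
have forcesM : forces_mono_path k.+3 q n M.
  by rewrite /M; case: q hq {n_large q_gt0 M} => [|[|q]] // _; apply: card_upclosed_forces.
have M_le : (M <= iter k.+1 (expn 2) (2 * n ^ q.-1))%N.
  rewrite iterSr; apply: iter_expn_lt.
  by case: q hq {n_large q_gt0 M forcesM} => [|[|q]] // _; apply: card_upclosed_lt.
have [N numN N_le] := mono_path_number_exists forcesM.
exists N; split=> //; rewrite subn1; split; last first.
  have := leq_trans N_le M_le; rewrite -(ler_nat R) iter_expn_powR natrM natrX.
  by apply.
set y := n%:R ^+ q.-1 / _.
have [s m_large] := large_layer R n_large q_gt0.
have yE : y = 1 / 2 * (n%:R ^+ q.-1 / Num.sqrt q%:R).
  by rewrite /y invfM mulrCA div1r.
rewrite leNgt; apply/negP => /ltW N_small.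
have y30 : 30 <= y.
  have r1 : 1 <= Num.sqrt q%:R :> R by rewrite -[leLHS]sqrtr1 ler_wsqrtr ?ler1n.
  have r2 : Num.sqrt q%:R ^+ 2 = q%:R :> R by rewrite sqr_sqrtr.
  have n_le : n%:R <= n%:R ^+ q.-1 :> R.
    by rewrite -natrX ler_nat -[leqLHS]expn1 leq_pexp2l //; lia.
  move: n_large; rewrite -(ler_nat R) natrM -r2 => n_large.
  rewrite /y ler_pdivlMr; nra.
have ym : 6 / 5 * y <= #|layer n q s|%:R by rewrite yE; lra.
have := shift_free_tower (i := k.+1) y30 ym N_small.
case/shift_free_dominates/(shift_free_no_mono_path q_gt0) => chi.
by apply; case: numN => + _; apply.
Qed.
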